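(* Let $d\ge2$, $\varepsilon>0$, $N\in\mathbb{N}$, and let $w_1,\dots,w_N>0$ be weights independent of $t$ and $\mathbf{z}$. Let $\{v_i(t,\mathbf{z})\}_{i=1}^N$, with $v_i(t,\mathbf{z})\in\mathbb{R}^d$ for $t\ge0$ and $\mathbf{z}\in I_{\mathbf{z}}$, be a solution of the particle scheme $$\frac{\mathrm{d} v_i(t,\mathbf{z})}{\mathrm{d}t} = - \sum_{j=1}^N w_j\, A_{ij}(t,\mathbf{z})\, b^N_{\varepsilon,ij}(t,\mathbf{z}),\qquad i=1,\dots,N,$$ for the regularised homogeneous Landau equation with uncertainty, where $b^N_{\varepsilon,ij}$ is given by either the symmetric or the anti-symmetric regularisation of the entropy. Then, for every $t\ge 0$, $$\sum_{i=1}^N w_i\| v_i(t,\mathbf{z}) \|^2_{L^2(I_{\mathbf{z}})} = \sum_{i=1}^N w_i \| v_i(0,\mathbf{z}) \|^2_{L^2(I_{\mathbf{z}})}.$$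
   Context: $\mathbf{z}\in I_{\mathbf{z}}\subseteq\mathbb{R}^{d_{\mathbf{z}}}$ is a random vector with probability density $p(\mathbf{z})$, and $\|u\|^2_{L^2(I_{\mathbf{z}})}=\int_{I_{\mathbf{z}}}|u(\mathbf{z})|^2p(\mathbf{z})\,\mathrm{d}\mathbf{z}$. The Landau collision kernel is $A(q) = C |q|^{\gamma+2} S(q)$, $S(q) = I - \frac{q \otimes q}{|q|^2}$, for $q\in\mathbb{R}^d\setminus\{0\}$, with $C>0$, $-d-1\le\gamma\le 1$, $I$ the $d\times d$ identity matrix, and the convention $A(0)=0$ (immaterial in the scheme). The model parameters in $A$ (e.g. the exponent $\gamma$) may depend on $\mathbf{z}$. Set $A_{ij}(t,\mathbf{z})=A(v_i(t,\mathbf{z})-v_j(t,\mathbf{z}))$. The Gaussian mollifier is $\psi_\varepsilon (v) = \frac{1}{(2\pi\varepsilon)^{d/2}}\exp\left(-\frac{|v|^2}{2\varepsilon}\right)$, and $\tilde{f}^N(v,t,\mathbf{z}) = \sum_{i=1}^N w_i \psi_\varepsilon(v-v_i(t,\mathbf{z}))$. Set $b^N_{\varepsilon,ij}(t,\mathbf{z})=g_i(t,\mathbf{z})-g_j(t,\mathbf{z})$, where $g_i$ (the gradient of the variation of the regularised entropy, evaluated at $v_i$) is, omitting the time dependence, (a) symmetric regularisation: $g_i(\mathbf{z}) = \int_{\mathbb{R}^d} \nabla\psi_\varepsilon(v_i(\mathbf{z})-v) \log\left( \tilde{f}^{N}(v,\mathbf{z}) \right) \mathrm{d}v$; (b) anti-symmetric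 regularisation: $g_i(\mathbf{z}) = \frac{\nabla\tilde{f}^{N}(v_i(\mathbf{z}),\mathbf{z})}{\tilde{f}^{N}(v_i(\mathbf{z}),\mathbf{z})} + \sum_{j=1}^N w_j \frac{\nabla\psi_\varepsilon(v_i(\mathbf{z})-v_j(\mathbf{z}))}{\tilde{f}^{N}(v_j(\mathbf{z}),\mathbf{z})}$, where $\nabla$ is the gradient in the velocity variable. *)

(* Defs.v *)
From HB Require Import structures.
From mathcomp Require Import all_boot all_order all_algebra.
From mathcomp Require Import all_classical all_reals all_analysis.

Set Implicit Arguments.
Unset Strict Implicit.
Unset Printing Implicit Defensive.

Import Order.TTheory GRing.Theory Num.Theory.
Import numFieldNormedType.Exports.

Local Open Scope classical_set_scope.
Local Open Scope ring_scope.

Section cons_measure.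
Context d (T : measurableType d) (R : realType).
Context (mu : {sigma_finite_measure set T -> \bar R}) (n : nat).
Context (nu : {sigma_finite_measure set (n.-tuple T) -> \bar R}).

Definition consX (x : T * n.-tuple T) : n.+1.-tuple T := [tuple of x.1 :: x.2].

Let mconsX : measurable_fun setT consX.
Proof. exact: measurable_cons measurable_fst measurable_snd. Qed.

Definition cons_measure : set (n.+1.-tuple T) -> \bar R :=
  pushforward (mu \x nu)%E consX.

Let cons_measure0 : cons_measure set0 = 0%E.
Proof. by rewrite /cons_measure /pushforward preimage_set0 measure0. Qed.

Let cons_measure_ge0 A : (0 <= cons_measure A)%E.
Proof. exact: measure_ge0. Qed.

Let cons_measure_sigma_additive : semi_sigma_additive cons_measure.
Proof.
exact: measure_semi_sigma_additive.
Qed.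

HB.instance Definition _ := isMeasure.Build _ _ _ cons_measure
  cons_measure0 cons_measure_ge0 cons_measure_sigma_additive.

Let cons_measure_sigma_finite : sigma_finite setT cons_measure.
Proof.
have /sigma_finiteP[F [TF ndF mF]] := sigma_finiteT mu.
have /sigma_finiteP[G [TG ndG mG]] := sigma_finiteT nu.
pose uncons (t : n.+1.-tuple T) := (thead t, [tuple of behead t]).
have muncons : measurable_fun setT uncons.
  by apply/measurable_fun_pairP; split;
    [exact: measurable_tnth|exact: measurable_behead].
have consXK : cancel consX uncons.
  by case=> a t; rewrite /uncons /consX theadE; congr pair; apply/val_inj.
exists (fun k => uncons @^-1` (F k `*` G k)).
  apply/esym; rewrite -subTset => t _.
  have [i _ Fi] : (\bigcup_i F i) (uncons t).1 by rewrite -TF.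
  have [j _ Gj] : (\bigcup_i G i) (uncons t).2 by rewrite -TG.
  exists (maxn i j) => //; split => /=.
  - by move: Fi; exact/subsetPset/ndF/leq_maxl.
  - by move: Gj; exact/subsetPset/ndG/leq_maxr.
move=> k; have [mFk Fk] := mF k; have [mGk Gk] := mG k; split.
  by rewrite -[X in measurable X]setTI; apply: muncons => //; exact: measurableX.
rewrite /cons_measure /pushforward -comp_preimage.
rewrite (_ : uncons \o _ = id); last by apply/funext => x; exact: consXK.
by rewrite preimage_id product_measure1E// lte_mul_pinfty// ge0_fin_numE.
Qed.

HB.instance Definition _ := Measure_isSigmaFinite.Build _ _ _ cons_measure
  cons_measure_sigma_finite.

End cons_measure.

Fixpoint tuple_measure d (T : measurableType d) (R : realType)
    (mu : {sigma_finite_measure set T -> \bar R}) (n : nat) :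
    {sigma_finite_measure set (n.-tuple T) -> \bar R} :=
  if n is n'.+1 then cons_measure mu (tuple_measure mu n')
  else \d_ [tuple].

(* The Lebesgue measure on R^n, with R^n represented by n-tuples: the library
   provides a sigma-algebra on tuples but none on column vectors. *)
Definition lebesgue_tuple (R : realType) (n : nat) :
    {sigma_finite_measure set (n.-tuple (measurableTypeR R)) -> \bar R} :=
  tuple_measure (@lebesgue_measure R) n.

(* The library norm of a matrix is the sup norm, not this one. *)
Definition enorm (R : realType) (n : nat) (u : 'cV[R]_n) : R :=
  Num.sqrt (\sum_(k < n) u k ord0 ^+ 2).

Definition grad (R : realType) (n : nat) (f : 'cV[R]_n -> R) (x : 'cV[R]_n) :
    'cV[R]_n :=
  \col_k 'D_(delta_mx k ord0) f x.

Section random_space.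
Context (R : realType) (m : nat).
Implicit Types (I : set (m.-tuple (measurableTypeR R)))
  (p : m.-tuple (measurableTypeR R) -> R).

Definition is_density I p : Prop :=
  [/\ measurable_fun I p, (forall z, I z -> 0 <= p z) &
      (\int[lebesgue_tuple R m]_(z in I) (p z)%:E = 1)%E].

(* Extended-real valued, so that it makes sense (as +oo) for a measurable u
   that is not square integrable. *)
Definition L2norm_sq I p n (u : m.-tuple (measurableTypeR R) -> 'cV[R]_n) :
    \bar R :=
  (\int[lebesgue_tuple R m]_(z in I) (enorm (u z) ^+ 2 * p z)%:E)%E.

End random_space.

Inductive regularisation := Symmetric | Antisymmetric.

Section particle_scheme.
Context (R : realType) (d N : nat).
Implicit Types (q u : 'cV[R]_d) (x : 'I_N -> 'cV[R]_d).

Definition landau_kernel (C gamma : R) q : 'M[R]_d :=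
  if q == 0 then 0
  else (C * enorm q `^ (gamma + 2)) *:
         (1%:M - (enorm q ^+ 2)^-1 *: (q *m q^T)).

Context (eps : R) (w : 'I_N -> R).

Definition mollifier u : R :=
  ((2 * pi * eps) `^ (d%:R / 2))^-1 * expR (- (enorm u ^+ 2 / (2 * eps))).

Definition smoothed_density x u : R :=
  \sum_(i < N) w i * mollifier (u - x i).

Definition entropy_grad_sym x (i : 'I_N) : 'cV[R]_d :=
  \col_k \int[lebesgue_tuple R d]_u
    (let u' : 'cV[R]_d := \col_l tnth u l in
     grad mollifier (x i - u') k ord0 * ln (smoothed_density x u')).

Definition entropy_grad_antisym x (i : 'I_N) : 'cV[R]_d :=
  (smoothed_density x (x i))^-1 *: grad (smoothed_density x) (x i) +
  \sum_(j < N) (w j / smoothed_density x (x j)) *: grad mollifier (x i - x j).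

Definition entropy_grad (reg : regularisation) x (i : 'I_N) : 'cV[R]_d :=
  match reg with
  | Symmetric => entropy_grad_sym x i
  | Antisymmetric => entropy_grad_antisym x i
  end.

Definition scheme_rhs (reg : regularisation) (C gamma : R) x (i : 'I_N) :
    'cV[R]_d :=
  - \sum_(j < N) w j *: (landau_kernel C gamma (x i - x j) *m
                         (entropy_grad reg x i - entropy_grad reg x j)).

(* The trajectories v are total functions on R; only times t >= 0 matter.  At
   t = 0 only right continuity is asked for. *)
Definition scheme_solution (reg : regularisation) (C gamma : R)
    (v : 'I_N -> R -> 'cV[R]_d) : Prop :=
  forall i : 'I_N,
    {within `[0, +oo[, continuous (v i)} /\
    forall t : R, 0 < t ->
      is_derive t 1 (v i) (scheme_rhs reg C gamma (v ^~ t) i).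

End particle_scheme.

(* Main.v *)
Require Import Defs.
From HB Require Import structures.
From mathcomp Require Import all_boot all_order all_algebra.
From mathcomp Require Import all_classical all_reals all_analysis.
From mathcomp Require Import measurable_realfun.

(** The kinetic energy [\sum_i w i * |v_i|^2] is conserved for each value of
    the random parameter z separately, and the theorem follows by integrating
    this identity against the density p.

    For fixed z, the derivative of the energy is
    [- 2 * \sum_(i, j) w_i w_j v_i . F_ij], with [F_ij = A_ij b_ij].  The
    kernel A is even and b_ij is antisymmetric, so F_ij = - F_ji; exchanging i
    and j therefore turns the double sum into half of
    [\sum_(i, j) w_i w_j (v_i - v_j) . F_ij].  Every term of the latter vanishes
    because A(q) projects onto the orthogonal of q: F_ij is orthogonal to
    v_i - v_j ([trmx_mul_landau_kernel], [antisymmetric_interaction_work]).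
    The antisymmetry of b_ij comes from its form g_i - g_j, which the two
    regularisations of the entropy share.

    A trajectory is differentiable at positive times only and merely right
    continuous at 0, so constancy of the energy comes from the mean value
    theorem on [[0, t]] ([scheme_kinetic_energy_cst]).

    The second moments may be infinite.  All integrands being nonnegative, the
    weighted sum of the squared norms is nevertheless the integral of the
    energy density, in the extended reals ([L2norm_sq_wsum]). *)

Set Implicit Arguments.
Unset Strict Implicit.
Unset Printing Implicit Defensive.

Import Order.TTheory GRing.Theory Num.Theory.
Import numFieldNormedType.Exports.

Local Open Scope classical_set_scope.
Local Open Scope ring_scope.

Section kernel.
Context (R : realType) (d : nat).
Implicit Types q u : 'cV[R]_d.

Lemma sqr_enorm u : enorm u ^+ 2 = \sum_(k < d) u k ord0 ^+ 2.
Proof. by rewrite sqr_sqrtr// sumr_ge0// => k _; exact: sqr_ge0. Qed.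

Lemma enormN u : enorm (- u) = enorm u.
Proof. by congr Num.sqrt; apply: eq_bigr => k _; rewrite !mxE sqrrN. Qed.

Lemma trmx_mul_self u : u^T *m u = (enorm u ^+ 2)%:M.
Proof.
rewrite [LHS]mx11_scalar; congr (_%:M).
by rewrite sqr_enorm mxE; apply: eq_bigr => k _; rewrite mxE expr2.
Qed.

Lemma sqr_enorm_eq0 u : (enorm u ^+ 2 == 0) = (u == 0).
Proof.
apply/eqP/eqP => [|->]; last first.
  by rewrite sqr_enorm big1// => k _; rewrite mxE expr0n.
rewrite sqr_enorm => /psumr_eq0P u0; apply/colP => k; rewrite mxE.
by apply/eqP; rewrite -sqrf_eq0 u0// => i _; exact: sqr_ge0.
Qed.

(** The topology on column vectors comes from the sup norm, so continuity of
    the Euclidean norm goes through the coordinates. *)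
Lemma continuous_sqr_enorm : continuous (fun u => enorm u ^+ 2).
Proof.
under eq_fun do rewrite sqr_enorm.
apply: continuous_big => [|k _ u]; first exact: add_continuous.
under [X in continuous_at _ X]eq_fun do rewrite expr2.
have uk := @coord_continuous R d 1 k ord0 u.
exact: (continuousM uk uk).
Qed.

Lemma landau_kernelN C gamma q :
  landau_kernel C gamma (- q) = landau_kernel C gamma q.
Proof.
by rewrite /landau_kernel oppr_eq0 enormN linearN/= mulNmx mulmxN opprK.
Qed.

(** Away from 0 this says that A(q) is a multiple of the projection onto the
    orthogonal of q; the convention A(0) = 0 makes it true at q = 0 as well. *)
Lemma trmx_mul_landau_kernel C gamma q : q^T *m landau_kernel C gamma q = 0.
Proof.
rewrite /landau_kernel; case: ifPn => [_|q0]; first by rewrite mulmx0.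
rewrite -scalemxAr mulmxBr mulmx1 -scalemxAr mulmxA trmx_mul_self.
by rewrite mul_scalar_mx scalerA mulVf ?sqr_enorm_eq0// scale1r subrr scaler0.
Qed.

End kernel.

(** Pairwise forces obeying the action-reaction law and orthogonal to the
    relative position do no work in total: swapping i and j shows that the
    double sum S of the works equals - S, since orthogonality allows x_j to be
    replaced by x_i in the term paired with F i j.  The scalar products are
    written as 1 x 1 matrices. *)
Lemma antisymmetric_interaction_work (R : realType) (d N : nat)
    (w : 'I_N -> R) (x : 'I_N -> 'cV[R]_d) (F : 'I_N -> 'I_N -> 'cV[R]_d) :
  (forall i j, F j i = - F i j) ->
  (forall i j, (x i - x j)^T *m F i j = 0) ->
  \sum_(i < N) w i *: ((x i)^T *m \sum_(j < N) w j *: F i j) = 0.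
Proof.
move=> Fanti Forth.
pose S := \sum_(i < N) \sum_(j < N) (w i * w j) *: ((x i)^T *m F i j).
transitivity S.
  apply: eq_bigr => i _; rewrite mulmx_sumr scaler_sumr.
  by apply: eq_bigr => j _; rewrite -scalemxAr scalerA.
have SN : S = - S.
  rewrite {1}/S exchange_big/= -sumrN; apply: eq_bigr => i _.
  rewrite -sumrN; apply: eq_bigr => j _.
  have /eqP := Forth i j; rewrite linearB/= mulmxBl subr_eq0 => /eqP ->.
  by rewrite Fanti mulmxN scalerN mulrC.
apply/eqP; have : 2%:R *: S == 0 by rewrite scaler_nat mulr2n {1}SN addNr.
by rewrite scaler_eq0 pnatr_eq0.
Qed.

(** Linearity of the integral with nonnegative integrands and weights; both
    sides may be infinite. *)
Lemma L2norm_sq_wsum (R : realType) (d N m : nat)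
    (Iz : set (m.-tuple (measurableTypeR R))) (Iz_meas : measurable Iz)
    (p : m.-tuple (measurableTypeR R) -> R) (p_density : is_density Iz p)
    (w : 'I_N -> R) (w_ge0 : forall i, 0 <= w i)
    (u : 'I_N -> m.-tuple (measurableTypeR R) -> 'cV[R]_d)
    (u_meas : forall i k, measurable_fun Iz (fun z => u i z k ord0)) :
  (\sum_(i < N) (w i)%:E * L2norm_sq Iz p (u i) =
   \int[lebesgue_tuple R m]_(z in Iz)
     ((\sum_(i < N) w i * enorm (u i z) ^+ 2) * p z)%:E)%E.
Proof.
have [p_meas p_ge0 _] := p_density.
have f_ge0 i z : Iz z -> (0 <= (enorm (u i z) ^+ 2 * p z)%:E)%E.
  by move=> Iz_z; rewrite lee_fin mulr_ge0 ?sqr_ge0 ?p_ge0.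
have f_meas i :
    measurable_fun Iz (fun z => enorm (u i z) ^+ 2 * p z).
  apply: measurable_funM => //.
  under eq_fun do rewrite sqr_enorm.
  by apply: measurable_sum => k; apply: measurable_funX.
rewrite /L2norm_sq.
under eq_bigr => i _.
  rewrite -ge0_integralZl//; last 3 first.
  - exact/measurable_EFinP.
  - exact: f_ge0.
  - by rewrite lee_fin.
  over.
rewrite -ge0_integral_sum//; last 2 first.
- by move=> i; apply: emeasurable_funM => //; exact/measurable_EFinP.
- by move=> i z Iz_z; rewrite mule_ge0 ?lee_fin// -lee_fin f_ge0.
apply: eq_integral => z _; rewrite mulr_suml -sumEFin.
by apply: eq_bigr => i _; rewrite -EFinM mulrA.
Qed.

Section energy.
Context (R : realType) (d N : nat) (w : 'I_N -> R).

(** Twice the physical kinetic energy: the factor 1/2 is dropped to match the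
    second moments. *)
Definition kinetic_energy (x : 'I_N -> 'cV[R]_d) : R :=
  \sum_(i < N) w i * enorm (x i) ^+ 2.

Lemma is_derive_sqr_enorm (u : R -> 'cV[R]_d) (t : R) (du : 'cV[R]_d) :
  is_derive t 1 u du ->
  is_derive t 1 (fun s => enorm (u s) ^+ 2) (2 * ((u t)^T *m du) ord0 ord0).
Proof.
move=> u_du.
have u_drv : derivable u t 1 by [].
have du_k k : is_derive t 1 (fun s => u s k ord0) (du k ord0).
  apply: DeriveDef; first by move/derivable_mxP : u_drv; exact.
  by rewrite -[du](@derive_val _ _ _ _ _ _ _ u_du) derive_mx// mxE.
rewrite (_ : (fun _ => _) = \sum_(k < d) (fun s => u s k ord0) ^+ 2);
  last first.
  by apply/funext => s; rewrite sqr_enorm fct_sumE.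
apply: is_derive_eq.
rewrite mxE mulr_sumr; apply: eq_bigr => k _.
by rewrite mxE/= expr1 mulrA.
Qed.

Lemma within_continuous_kinetic_energy (D : set R)
    (x : 'I_N -> R -> 'cV[R]_d) :
  (forall i, {within D, continuous (x i)}) ->
  {within D, continuous (fun t => kinetic_energy (x ^~ t))}.
Proof.
move=> x_cont; apply: continuous_big => [|i _ t]; first exact: add_continuous.
apply: cvgM; first exact: cvg_cst.
exact: (continuous_comp (x_cont i t) (@continuous_sqr_enorm R d (x i t))).
Qed.

Context (eps : R) (reg : regularisation) (C gamma : R).

Lemma scheme_rhs_work (x : 'I_N -> 'cV[R]_d) :
  \sum_(i < N) w i *:
    ((x i)^T *m scheme_rhs eps w reg C gamma x i) = 0.
Proof.
under eq_bigr do rewrite mulmxN scalerN.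
rewrite sumrN antisymmetric_interaction_work ?oppr0// => i j.
- by rewrite -[x j - x i]opprB landau_kernelN -mulmxN opprB.
- by rewrite mulmxA trmx_mul_landau_kernel mul0mx.
Qed.

(** The equation of motion is available on the open half line only; continuity
    up to time 0 is what lets the mean value theorem reach the initial datum. *)
Lemma scheme_kinetic_energy_cst (x : 'I_N -> R -> 'cV[R]_d) :
  scheme_solution eps w reg C gamma x ->
  forall t, 0 <= t -> kinetic_energy (x ^~ t) = kinetic_energy (x ^~ 0).
Proof.
move=> x_sol t; rewrite le_eqVlt => /predU1P[<-//|t_gt0].
pose E s := kinetic_energy (x ^~ s).
have E_drv s : s \in `]0, t[ -> is_derive s 1 E 0.
  rewrite in_itv/= => /andP[s_gt0 _].
  have x_drv i := is_derive_sqr_enorm ((x_sol i).2 s s_gt0).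
  (* Written as a sum of functions, E is differentiated by instance search. *)
  rewrite (_ : E = \sum_(i < N) w i \*: (fun s => enorm (x i s) ^+ 2));
    last first.
    by apply/funext => r; rewrite fct_sumE.
  apply: is_derive_eq.
  have /matrixP/(_ ord0 ord0) := scheme_rhs_work (x ^~ s).
  rewrite summxE [RHS]mxE => work0.
  rewrite -[RHS](mulr0 2) -[X in _ = 2 * X]work0 mulr_sumr.
  apply: eq_bigr => i _.
  by rewrite [in RHS]mxE -[LHS]/(w i * (2 * _)) mulrCA.
have E_cont : {within `[0, +oo[, continuous E}.
  by apply: within_continuous_kinetic_energy => i; exact: (x_sol i).1.
have E_cont_t : {within `[0, t], continuous E}.
  apply: (continuous_subspaceW _ E_cont) => s /=.
  by rewrite !in_itv/= => /andP[->].
have [c _] := MVT t_gt0 E_drv E_cont_t.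
by rewrite mul0r => /eqP; rewrite subr_eq0 => /eqP.
Qed.

End energy.

Theorem theorem3 (R : realType) (d N m : nat) (d_ge2 : (2 <= d)%N)
    (Iz : set (m.-tuple (measurableTypeR R))) (Iz_meas : measurable Iz)
    (p : m.-tuple (measurableTypeR R) -> R) (p_density : is_density Iz p)
    (C gamma : m.-tuple (measurableTypeR R) -> R)
    (C_gt0 : forall z, Iz z -> 0 < C z)
    (gamma_range : forall z, Iz z -> - d%:R - 1 <= gamma z <= 1)
    (eps : R) (eps_gt0 : 0 < eps)
    (w : 'I_N -> R) (w_gt0 : forall i, 0 < w i)
    (reg : regularisation)
    (v : 'I_N -> R -> m.-tuple (measurableTypeR R) -> 'cV[R]_d)
    (v_meas : forall i t k, 0 <= t ->
      measurable_fun Iz (fun z => v i t z k ord0))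
    (v_sol : forall z, Iz z ->
      scheme_solution eps w reg (C z) (gamma z) (fun i t => v i t z)) :
  forall t : R, 0 <= t ->
    (\sum_(i < N) (w i)%:E * L2norm_sq Iz p (v i t) =
     \sum_(i < N) (w i)%:E * L2norm_sq Iz p (v i 0%R))%E.
Proof.
move=> t t_ge0.
have w_ge0 i : 0 <= w i by exact: ltW.
have E r : 0 <= r -> _ := fun r_ge0 => L2norm_sq_wsum Iz_meas p_density w_ge0
  (fun i k => v_meas i r k r_ge0).
rewrite E// E//.
apply: eq_integral => z /set_mem Iz_z; congr (_ * _)%:E.
exact: (scheme_kinetic_energy_cst (v_sol z Iz_z)).
Qed.
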